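(* Let $X$ be a finite set of variables, $\preceq$ a monomial ordering, and $Q \subseteq \mathbb{Q}[X]$ a finite set of polynomials. Consider the procedure $\mathsf{saturate}(Q)$: initialize $Z := \emptyset$ and $P := Q \cup \{1\}$; while there exists a non-zero $t \in \mathrm{units}(\mathrm{cone}(P))$, choose any such $t$, let $G$ be a Gröbner basis of the ideal generated by $Z \cup \{t\}$ with respect to $\preceq$, and set $Z := G$ and $P := \{\mathbf{red}_G(p) : p \in P,\ \mathbf{red}_G(p) \neq 0\}$; when no such $t$ exists, return $\langle Z,P\rangle$. Then this procedure terminates, and the pair $\langle Z,P\rangle$ it returns satisfies that $\mathrm{alg.cone}(Z,P)$ is the least regular cone in $\mathbb{Q}[X]$ that contains $Q$.
   Context: A cone in $\mathbb{Q}[X]$ is a subset containing $0$ closed under addition and multiplication by non-negative rationals; $\mathrm{cone}(P)$ is the set of non-negative rational combinations of elements of $P$. For a cone $C$, $\mathrm{units}(C) = \{p : p \in C, -p\in C\}$. A regular cone is a cone $C$ with $1 \in C$ such that $\mathrm{units}(C)$ is an ideal of $\mathbb{Q}[X]$. $\mathrm{alg.cone}(Z,P) = \langle Z\rangle + \mathrm{cone}(P)$, where $\langle Z\rangle$ is the ideal generated by $Z$. $\mathbf{red}_G(p)$ denotes the normal form of $p$ modulo the Gröbner basis $G$. *)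

(* Defs.v *)
From Stdlib Require Import Relations.
From HB Require Import structures.
From mathcomp Require Import all_boot all_order all_algebra.
From mathcomp Require Import finmap.
From mathcomp.multinomials Require Import mpoly.

Set Implicit Arguments.
Unset Strict Implicit.
Unset Printing Implicit Defensive.

Import Order.TTheory GRing.Theory Num.Theory.

Open Scope fset_scope.
Open Scope ring_scope.

(* Finite sets of polynomials are of type {fset {mpoly rat[n]}}; arbitrary
   sets of polynomials (ideals, cones) are predicates to Prop. *)

Section Ideals.
Variable n : nat.
Implicit Types (I S : {mpoly rat[n]} -> Prop) (p q : {mpoly rat[n]}).

(* The ideals of mathcomp's ring_quotient are proper and decidable; here the
   unit ideal must be allowed. *)
Definition is_ideal I : Prop :=
  [/\ I 0, forall p q, I p -> I q -> I (p + q) & forall p q, I q -> I (p * q)].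

Definition ideal_gen S p : Prop :=
  exists r : seq ({mpoly rat[n]} * {mpoly rat[n]}),
    (forall x, x \in r -> S x.2) /\ p = \sum_(x <- r) x.1 * x.2.

End Ideals.

Section Cones.
Variable n : nat.
Implicit Types (C S : {mpoly rat[n]} -> Prop) (p q : {mpoly rat[n]}).
Implicit Types (Z P Q : {fset {mpoly rat[n]}}).

Definition is_cone C : Prop :=
  [/\ C 0, forall p q, C p -> C q -> C (p + q)
    & forall (a : rat) p, 0 <= a -> C p -> C (a *: p)].

Definition cone P p : Prop :=
  exists r : seq (rat * {mpoly rat[n]}),
    (forall x, x \in r -> 0 <= x.1 /\ x.2 \in P) /\
    p = \sum_(x <- r) x.1 *: x.2.

Definition units C p : Prop := C p /\ C (- p).

Definition regular_cone C : Prop :=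
  [/\ is_cone C, C 1 & is_ideal (units C)].

Definition alg_cone Z P p : Prop :=
  exists z q, [/\ ideal_gen (fun g => g \in Z) z, cone P q & p = z + q].

Definition least_regular_cone_containing Q C : Prop :=
  [/\ regular_cone C, forall q, q \in Q -> C q
    & forall D, regular_cone D -> (forall q, q \in Q -> D q) ->
        forall p, C p -> D p].

End Cones.

Section Groebner.
Variable n : nat.
Implicit Types (m : 'X_{1..n}) (p r g : {mpoly rat[n]}).
Implicit Types (I : {mpoly rat[n]} -> Prop) (G : {fset {mpoly rat[n]}}).

(* Monomials are written additively in 'X_{1..n}: 0%MM is the monomial 1 and
   (m1 + m2)%MM is the product.  By Dickson's lemma such an order is a
   well-order. *)
Definition monomial_order (le : rel 'X_{1..n}) : Prop :=
  [/\ reflexive le, antisymmetric le, transitive le & total le] /\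
  (forall m, le 0%MM m) /\
  (forall m1 m2 m, le m1 m2 -> le (m1 + m)%MM (m2 + m)%MM).

Variable le : rel 'X_{1..n}.

(* The library's mlead is tied to one fixed order.  As 0%MM is minimal for a
   monomial order, the default value is harmless for p != 0. *)
Definition lead_mon p : 'X_{1..n} :=
  \big[(fun m1 m2 => if le m1 m2 then m2 else m1)/0%MM]_(m <- msupp p) m.

Definition lead_term p : {mpoly rat[n]} :=
  p@_(lead_mon p) *: 'X_[lead_mon p].

Definition groebner_basis I G : Prop :=
  (forall g, g \in G -> I g) /\
  (forall p,
     ideal_gen (fun l => exists2 g, g \in G & l = lead_term g) p <->
     ideal_gen (fun l => exists2 f, I f & l = lead_term f) p).

(* One reduction step cancels the term of p at a monomial m (not necessarily
   the leading one) by a multiple of an element of G. *)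
Definition reduces1 G p r : Prop :=
  exists g m,
    [/\ g \in G, g != 0, m \in msupp p, (lead_mon g <= m)%MM
      & r = p - (p@_m / g@_(lead_mon g)) *: ('X_[m - lead_mon g] * g)].

Definition normal_form G p r : Prop :=
  clos_refl_trans _ (reduces1 G) p r /\ ~ (exists r', reduces1 G r r').

End Groebner.

Section Saturate.
Variable n : nat.
Variable le : rel 'X_{1..n}.

(* A state is the pair (Z, P) of the procedure's variables. *)
Definition state : Type :=
  ({fset {mpoly rat[n]}} * {fset {mpoly rat[n]}})%type.

Definition saturate_init (Q : {fset {mpoly rat[n]}}) : state :=
  (fset0, Q `|` [fset 1]).

(* All choices (of t, of the Groebner basis) are left nondeterministic. *)
Definition saturate_step (s s' : state) : Prop :=
  let: (Z, P) := s in let: (G, P') := s' in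
  exists t : {mpoly rat[n]},
    [/\ t != 0, units (cone P) t,
        groebner_basis le (ideal_gen (fun g => g \in Z `|` [fset t])) G
      & exists red : {mpoly rat[n]} -> {mpoly rat[n]},
          (forall p, normal_form le G p (red p)) /\
          P' = [fset red p | p in P & red p != 0]].

Definition saturate_halted (s : state) : Prop :=
  ~ (exists t : {mpoly rat[n]}, t != 0 /\ units (cone s.2) t).

Definition saturate_reaches (Q : {fset {mpoly rat[n]}}) (s : state) : Prop :=
  clos_refl_trans _ saturate_step (saturate_init Q) s.

Definition saturate_returns (Q : {fset {mpoly rat[n]}}) (s : state) : Prop :=
  saturate_reaches Q s /\ saturate_halted s.

(* No sequence of choices gives an infinite run, and no run gets stuck before
   the exit condition of the loop holds. *)
Definition saturate_terminates (Q : {fset {mpoly rat[n]}}) : Prop :=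
  Acc (fun s' s => saturate_step s s') (saturate_init Q) /\
  (forall s, saturate_reaches Q s ->
     saturate_halted s \/ exists s', saturate_step s s').

End Saturate.

(* Main.v *)
Require Import Defs.
From Stdlib Require Import Classical ClassicalEpsilon Relations.
From mathcomp Require Import all_boot all_order all_algebra.
From mathcomp Require Import finmap.
From mathcomp.multinomials Require Import mpoly.

Set Implicit Arguments.
Unset Strict Implicit.
Unset Printing Implicit Defensive.

Import Order.TTheory GRing.Theory Num.Theory.

(* Normal forms modulo a Groebner basis G of I form a linear map with kernel I.
   A non-zero t in units (cone P) lies in the span of P and is sent to 0, so
   each iteration strictly lowers the dimension of the span of P: no ascending
   chain of ideals is needed.  Dickson's lemma provides the Groebner bases and
   the well-foundedness of the monomial order, hence normal forms, so no run
   gets stuck.  Along a run alg_cone Z P can only grow, while Z stays in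
   units D and P in D for every regular cone D containing Q.  The elements of
   P are irreducible modulo Z, so cone P meets the ideal <Z> only in 0; on
   halting this makes units (alg_cone Z P) equal to <Z>, an ideal. *)

(** * Dickson's lemma *)

Section Dickson.
Variable n : nat.
Implicit Types (A B : 'X_{1..n} -> Prop) (m : 'X_{1..n}).

Definition has_finite_basis A : Prop :=
  exists s : seq 'X_{1..n},
    (forall m, m \in s -> A m) /\
    (forall m, A m -> exists2 b, b \in s & (b <= m)%MM).

(** Concatenate the bases of the finitely many slices [F i]. The slices need not cover [A]: in the
    application the multiples of a fixed monomial lie in none of them. *)
Lemma finite_basis_sub_union (T : eqType) (r : seq T) (F : T -> 'X_{1..n} -> Prop) A :
  (forall i, i \in r -> has_finite_basis (F i)) ->
  (forall i m, i \in r -> F i m -> A m) ->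
  exists s : seq 'X_{1..n},
    (forall m, m \in s -> A m) /\
    (forall i m, i \in r -> F i m -> exists2 b, b \in s & (b <= m)%MM).
Proof.
elim: r => [|i r IH] bF FA; first by exists [::].
have [||s [sA sF]] := IH.
- by move=> j jr; apply: bF; rewrite inE jr orbT.
- by move=> j m jr; apply: FA; rewrite inE jr orbT.
have [s' [s'F s'b]] := bF i (mem_head _ _).
exists (s' ++ s); split=> [m|j m].
  by rewrite mem_cat => /orP[/s'F|/sA //]; apply: FA; rewrite mem_head.
rewrite inE => /orP[/eqP ->|jr] Fm.
  by have [b bs bm] := s'b _ Fm; exists b; rewrite ?mem_cat ?bs.
by have [b bs bm] := sF _ _ jr Fm; exists b; rewrite ?mem_cat ?bs ?orbT.
Qed.

(* A monomial not divisible by a fixed m0 in A has some exponent below that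
   of m0, so it lies in one of finitely many slices of A in which one more
   exponent is constant. *)
Lemma dickson_slice k (D : {set 'I_n}) A :
  (#|~: D| <= k)%N ->
  (forall m m' i, A m -> A m' -> i \in D -> m i = m' i) ->
  has_finite_basis A.
Proof.
elim: k D A => [|k IH] D A cD AD.
(* Here every exponent is constant on [A], so [A] has at most one element. *)
- have [[m0 Am0]|nA] := classic (exists m, A m); last first.
    by exists [::]; split=> // m Am; case: nA; exists m.
  exists [:: m0]; split=> [m|m Am]; first by rewrite inE => /eqP ->.
  exists m0; rewrite ?mem_head //; apply/mnm_lepP => i.
  rewrite (AD _ _ _ Am0 Am) //.
  move: cD; rewrite leqn0 cards_eq0 => /eqP /setP /(_ i).
  by rewrite !inE => /negbFE.
- have [[m0 Am0]|nA] := classic (exists m, A m); last first.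
    by exists [::]; split=> // m Am; case: nA; exists m.
  pose r := [seq (i, c) | i <- enum 'I_n, c <- iota 0 (m0 i)].
  pose F (x : 'I_n * nat) m := [/\ A m, x.1 \notin D & m x.1 = x.2].
  have [||s [sA sF]] := @finite_basis_sub_union _ r F A.
  (* For [i] in [D] the slice is empty by the definition of [F]; otherwise [i] joins [D] and the
     induction hypothesis applies. *)
  + move=> [i c] _; have [iD|niD] := boolP (i \in D).
      by exists [::]; split=> // m []; rewrite /= iD.
    apply: (IH (i |: D)).
      rewrite -ltnS (leq_trans _ cD) // proper_card //.
      rewrite properEneq setCS subsetUr andbT.
      apply/eqP => /setP /(_ i); rewrite !inE eqxx niD //.
    move=> m m' j [Am _ mi] [Am' _ m'i]; rewrite !inE => /orP[/eqP ->|].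
      by rewrite mi m'i.
    exact: AD.
  + by move=> i m _ [].
  exists (m0 :: s); split=> [m|m Am].
    by rewrite inE => /orP[/eqP ->|/sA].
  have [m0m|/mnm_lepP nm0m] := boolP (m0 <= m)%MM.
    by exists m0; rewrite ?mem_head.
  have [i mi] : exists i, (m i < m0 i)%N.
    apply: NNPP => nex; apply: nm0m => i; rewrite leqNgt.
    by apply/negP => lt; apply: nex; exists i.
  have [||b bs bm] := sF (i, m i) m.
  + by apply/allpairsPdep; exists i, (m i); rewrite mem_enum mem_iota.
  + split=> //; apply/negP => iD.
    by move: mi; rewrite (AD _ _ _ Am Am0 iD) ltnn.
  by exists b; rewrite // inE bs orbT.
Qed.

Lemma dickson A : has_finite_basis A.
Proof. by apply: (@dickson_slice _ set0 A (leqnn _)) => m m' i _ _; rewrite inE. Qed.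

End Dickson.

(** * Generated ideals *)

Section Ideals.
Variable n : nat.
Implicit Types (I S : {mpoly rat[n]} -> Prop) (p q : {mpoly rat[n]}).

Lemma ideal_scale I (c : rat) p : is_ideal I -> I p -> I (c *: p).
Proof. by move=> [_ _ IM] Ip; rewrite -mul_mpolyC; apply: IM. Qed.

Lemma ideal_opp I p : is_ideal I -> I p -> I (- p).
Proof. by move=> idI Ip; rewrite -scaleN1r; apply: ideal_scale. Qed.

Lemma ideal_sub I p q : is_ideal I -> I p -> I q -> I (p - q).
Proof. by move=> idI Ip Iq; case: (idI) => _ ID _; apply: ID => //; apply: ideal_opp. Qed.

Lemma ideal_sum (T : eqType) (r : seq T) (F : T -> {mpoly rat[n]}) I :
  is_ideal I -> (forall i, i \in r -> I (F i)) -> I (\sum_(i <- r) F i).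
Proof.
move=> [I0 ID _] IF; rewrite big_seq.
by elim/big_ind: _ => //.
Qed.

Lemma ideal_gen_ideal S : is_ideal (ideal_gen S).
Proof.
split.
- by exists [::]; rewrite big_nil.
- move=> p q [r [rS ->]] [r' [r'S ->]]; exists (r ++ r'); rewrite big_cat.
  by split=> // x; rewrite mem_cat => /orP[/rS|/r'S].
- move=> p q [r [rS ->]]; exists [seq (p * x.1, x.2) | x <- r]; split.
    by move=> x /mapP[y yr ->] /=; apply: rS.
  by rewrite big_map mulr_sumr; apply: eq_bigr => x _; rewrite mulrA.
Qed.

Lemma ideal_gen_incl S p : S p -> ideal_gen S p.
Proof.
move=> Sp; exists [:: (1, p)]; rewrite big_seq1 mul1r; split=> // x.
by rewrite inE => /eqP ->.
Qed.

Lemma ideal_gen_min S I p :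
  is_ideal I -> (forall q, S q -> I q) -> ideal_gen S p -> I p.
Proof.
move=> idI SI [r [rS ->]]; apply: ideal_sum => // x xr.
by case: idI => _ _ IM; apply: IM; apply: SI; apply: rS.
Qed.

End Ideals.

(** * Finitely generated cones and algebraic cones *)

Section Cones.
Variable n : nat.
Implicit Types (C : {mpoly rat[n]} -> Prop) (p q : {mpoly rat[n]}).
Implicit Types (Z P : {fset {mpoly rat[n]}}).

Lemma cone_cone P : is_cone (cone P).
Proof.
split.
- by exists [::]; rewrite big_nil.
- move=> p q [r [rS ->]] [r' [r'S ->]]; exists (r ++ r'); rewrite big_cat.
  by split=> // x; rewrite mem_cat => /orP[/rS|/r'S].
- move=> a p a0 [r [rS ->]]; exists [seq (a * x.1, x.2) | x <- r]; split.
    by move=> x /mapP[y /rS[y0 yP] ->]; rewrite mulr_ge0.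
  by rewrite big_map scaler_sumr; apply: eq_bigr => x _; rewrite scalerA.
Qed.

Lemma cone_incl P p : p \in P -> cone P p.
Proof.
move=> pP; exists [:: (1, p)]; rewrite big_seq1 scale1r; split=> // x.
by rewrite inE => /eqP ->; rewrite ler01.
Qed.

Lemma cone_min P C p : is_cone C -> (forall q, q \in P -> C q) -> cone P p -> C p.
Proof.
move=> [C0 CD CZ] PC [r [rP ->]]; rewrite big_seq.
elim/big_ind: _ => // x /rP[x0 xP].
by apply: CZ => //; apply: PC.
Qed.

Lemma alg_cone_cone Z P : is_cone (alg_cone Z P).
Proof.
have [C0 CD CZ] := cone_cone P.
have idZ := ideal_gen_ideal (fun g : {mpoly rat[n]} => g \in Z).
have [I0 ID _] := idZ.
split.
- by exists 0, 0; rewrite addr0.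
- move=> _ _ [z [q [Iz Cq ->]]] [z' [q' [Iz' Cq' ->]]].
  by exists (z + z'), (q + q'); rewrite addrACA; split; [exact: ID|exact: CD|].
- move=> a _ a0 [z [q [Iz Cq ->]]]; exists (a *: z), (a *: q).
  by rewrite scalerDr; split; [exact: ideal_scale|exact: CZ|].
Qed.

Lemma alg_cone_ideal Z P p : ideal_gen (fun g => g \in Z) p -> alg_cone Z P p.
Proof. by move=> Zp; exists p, 0; rewrite addr0; split=> //; case: (cone_cone P). Qed.

Lemma alg_cone_incl Z P p : p \in P -> alg_cone Z P p.
Proof.
move=> pP; exists 0, p; rewrite add0r; split=> //; last exact: cone_incl.
by case: (ideal_gen_ideal (fun g : {mpoly rat[n]} => g \in Z)).
Qed.

Lemma alg_cone_min Z P C p : is_cone C -> is_ideal (units C) ->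
  (forall z, z \in Z -> units C z) -> (forall q, q \in P -> C q) ->
  alg_cone Z P p -> C p.
Proof.
move=> coneC idC ZC PC [z [q [Zz Pq ->]]]; case: (coneC) => _ CD _; apply: CD.
  by have [] := ideal_gen_min idC ZC Zz.
exact: cone_min Pq.
Qed.

(** If [p = z + q] and [- p = z' + q'], then [q + q' = - (z + z')] lies both in [cone P] and in the
    ideal, so it vanishes. Hence [q] is a unit of [cone P], thus 0, and [p = z]: the units are
    exactly the ideal generated by [Z]. *)
Lemma alg_cone_regular Z P :
  (forall p, cone P p -> ideal_gen (fun g => g \in Z) p -> p = 0) ->
  (forall p, units (cone P) p -> p = 0) ->
  alg_cone Z P 1 -> regular_cone (alg_cone Z P).
Proof.
move=> ZP0 uP0 one; split=> //; first exact: alg_cone_cone.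
have idZ := ideal_gen_ideal (fun g : {mpoly rat[n]} => g \in Z).
have [I0 ID IM] := idZ.
have unitsE p : units (alg_cone Z P) p <-> ideal_gen (fun g => g \in Z) p.
  split=> [|Zp]; last by split; apply: alg_cone_ideal => //; apply: ideal_opp.
  case=> -[z [q [Zz Pq pE]]] [z' [q' [Zz' Pq' NpE]]].
  have [_ CD _] := cone_cone P.
  have qq' : q + q' = 0.
    apply: ZP0; first exact: CD.
    suff -> : q + q' = - (z + z') by apply: ideal_opp => //; apply: ID.
    apply/eqP; rewrite -addr_eq0 addrC addrACA -pE -NpE subrr //.
  suff q0 : q = 0 by rewrite pE q0 addr0.
  apply: uP0; split=> //; suff -> : - q = q' by [].
  by apply/eqP; rewrite eqr_oppLR -addr_eq0 qq'.
split; first by apply/unitsE.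
- by move=> p q /unitsE Zp /unitsE Zq; apply/unitsE; apply: ID.
- by move=> p q /unitsE Zq; apply/unitsE; apply: IM.
Qed.

End Cones.

(** * Groebner bases and normal forms *)

Section Groebner.
Variables (n : nat) (le : rel 'X_{1..n}).
Hypothesis le_mon : monomial_order le.
Implicit Types (m : 'X_{1..n}) (p q r g t : {mpoly rat[n]}).
Implicit Types (I : {mpoly rat[n]} -> Prop) (G : {fset {mpoly rat[n]}}).

(** * Leading monomials and well-foundedness of the monomial order *)

Lemma bigmax_monP (s : seq 'X_{1..n}) :
  let b := \big[(fun m1 m2 => if le m1 m2 then m2 else m1)/0%MM]_(m <- s) m in
  (forall m, m \in s -> le m b) /\ (s != [::] -> b \in s).
Proof.
have [[le_refl le_asym le_trans le_tot] [le0 _]] := le_mon.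
elim: s => [|x s [IHle IHin]] //=; rewrite big_cons.
set b := \big[_/_]_(_ <- _) _ in IHle IHin *.
case: ifPn => [xb|nxb]; split=> [m|_].
- by rewrite inE => /orP[/eqP -> //|/IHle].
(* For an empty tail [b] is the default [0%MM], which need not be in the list; minimality of [0%MM]
   then forces [x = b]. *)
- have [s0|/IHin bs] := eqVneq s [::]; last by rewrite inE bs orbT.
  suff -> : b = x by rewrite mem_head.
  by apply: le_asym; rewrite xb andbT /b s0 big_nil le0.
- rewrite inE => /orP[/eqP -> //|/IHle mb]; apply: le_trans mb _.
  by have := le_tot x b; rewrite (negbTE nxb).
- by rewrite mem_head.
Qed.

Lemma lead_mon_max p m : m \in msupp p -> le m (lead_mon le p).
Proof. by have [H _] := bigmax_monP (msupp p); apply: H. Qed.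

Lemma lead_mon_supp p : p != 0 -> lead_mon le p \in msupp p.
Proof.
by rewrite -msupp_eq0; have [_ H] := bigmax_monP (msupp p); apply: H.
Qed.

Lemma lead_coef_neq0 p : p != 0 -> p@_(lead_mon le p) != 0.
Proof. by move/lead_mon_supp; rewrite mcoeff_msupp. Qed.

Lemma dvd_le_mon m1 m2 : (m1 <= m2)%MM -> le m1 m2.
Proof.
have [_ [le0 leD]] := le_mon.
by move=> /submK <-; rewrite -{1}[m1]add0m; apply: leD.
Qed.

Definition lt_mon m1 m2 : Prop := le m1 m2 && (m1 != m2).

Lemma seq_le_min (s : seq 'X_{1..n}) : s != [::] ->
  exists2 b, b \in s & forall m, m \in s -> le b m.
Proof.
have [[le_refl le_asym le_trans le_tot] _] := le_mon.
elim: s => // x s IH _; have [->|/IH[b bs bmin]] := eqVneq s [::].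
  by exists x; rewrite ?mem_head // => m; rewrite inE => /eqP ->.
case/orP: (le_tot x b) => [xb|bx].
  exists x; rewrite ?mem_head // => m; rewrite inE => /orP[/eqP -> //|/bmin].
  exact: le_trans.
exists b; first by rewrite inE bs orbT.
by move=> m; rewrite inE => /orP[/eqP -> //|/bmin].
Qed.

(** Take a finite basis of the inaccessible monomials and its least element [b]. An inaccessible [m]
    strictly below [b] would be a multiple of some basis element [c], and [b <= c <= m] in the order
    contradicts strictness; so [b] is accessible. *)
Lemma lt_mon_wf : well_founded lt_mon.
Proof.
have [[le_refl le_asym le_trans le_tot] _] := le_mon.
have [s [sA sb]] := dickson (fun m => ~ Acc lt_mon m).
have [s0|/seq_le_min[b bs bmin]] := eqVneq s [::].
  by move=> m; apply: NNPP => /sb[b]; rewrite s0.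
case: (sA b bs); constructor=> m /andP[mb neq]; apply: NNPP => /sb[c cs cm].
case/eqP: neq; apply: le_asym; rewrite mb /=.
exact: le_trans (bmin _ cs) (dvd_le_mon cm).
Qed.

(** The zero polynomial is excluded since its [lead_mon] is the default [0%MM], which divides every
    monomial. *)
Definition reducible G m : bool :=
  has (fun g => (g != 0) && (lead_mon le g <= m)%MM) (enum_fset G).

(** A condition on the support alone, hence stable under linear combinations. *)
Definition irreducible G p : Prop :=
  forall m, m \in msupp p -> ~~ reducible G m.

Lemma reducibleP G m :
  reflect (exists g, [/\ g \in G, g != 0 & (lead_mon le g <= m)%MM])
          (reducible G m).
Proof.
apply: (iffP hasP) => [[g gG /andP[g0 gm]]|[g [gG g0 gm]]]; exists g => //.
by rewrite g0.
Qed.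

Lemma irreducibleP G p :
  irreducible G p <-> ~ (exists r, reduces1 le G p r).
Proof.
split=> [irr [r [g [m [gG g0 mp gm _]]]]|nred m mp].
  by have /negP := irr m mp; apply; apply/reducibleP; exists g.
apply/negP => /reducibleP[g [gG g0 gm]]; apply: nred.
by eexists; exists g, m; split=> //.
Qed.

Lemma irreducible0 G : irreducible G 0.
Proof. by move=> m; rewrite msupp0. Qed.

Lemma irreducibleD G p q :
  irreducible G p -> irreducible G q -> irreducible G (p + q).
Proof.
by move=> ip iq m /msuppD_le; rewrite mem_cat => /orP[/ip|/iq].
Qed.

Lemma irreducibleZ G (c : rat) p : irreducible G p -> irreducible G (c *: p).
Proof. by move=> ip m /msuppZ_le /ip. Qed.

Lemma irreducible_cone G (P : {fset {mpoly rat[n]}}) p :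
  (forall q, q \in P -> irreducible G q) -> cone P p -> irreducible G p.
Proof.
apply: cone_min; split.
- exact: irreducible0.
- exact: irreducibleD.
- by move=> a q _; apply: irreducibleZ.
Qed.

Lemma reduct_coef g m : (lead_mon le g <= m)%MM ->
  ('X_[m - lead_mon le g] * g)@_m = g@_(lead_mon le g).
Proof. by move=> gm; rewrite mulrC -[X in _@_X](submK gm) mcoeffMX. Qed.

(** The multiple of [g] subtracted in a reduction at [m] has [m] as its top monomial, so the step
    disturbs nothing above [m]. *)
Lemma reduct_supp g m m' : (lead_mon le g <= m)%MM ->
  m' \in msupp ('X_[m - lead_mon le g] * g) -> le m' m.
Proof.
have [_ [_ leD]] := le_mon.
move=> gm; rewrite mulrC (perm_mem (msuppMX _ _)) => /mapP[k /lead_mon_max kg ->].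
by rewrite addmC -[X in le _ X](submK gm) [X in le _ X]addmC; apply: leD.
Qed.

(** * Existence of normal forms and their congruence modulo the ideal *)

Lemma normal_form_exists G p : exists r, normal_form le G p r.
Proof.
have [[le_refl le_asym le_trans le_tot] _] := le_mon.
(* Well-founded induction on a bound mu of the reducible monomials of p. *)
suff main mu : forall p, (forall m, m \in msupp p -> reducible G m -> le m mu) ->
    exists r, normal_form le G p r.
  have [H _] := bigmax_monP (msupp p); apply: main => m mp _; exact: H mp.
elim/(well_founded_ind lt_mon_wf): mu => mu IH {}p pmu.
(* At most one reduction, at [mu] itself, makes the bound strict. *)
have [p' [pp' p'mu]] : exists p', clos_refl_trans _ (reduces1 le G) p p' /\
    forall m, m \in msupp p' -> reducible G m -> lt_mon m mu.
  have [/andP[mup /reducibleP[g [gG g0 gmu]]]|] :=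
    boolP ((mu \in msupp p) && reducible G mu).
    eexists; split; first by apply: rt_step; exists g, mu; split.
    move=> m mp' rm; apply/andP; split.
      move: mp' => /msuppB_le; rewrite mem_cat => /orP[mp|]; first exact: pmu.
      by move=> /msuppZ_le /reduct_supp; apply.
    apply: contraL mp' => /eqP ->.
    rewrite -mcoeff_eq0 mcoeffB mcoeffZ reduct_coef // divfK ?subrr //.
    exact: lead_coef_neq0.
  move=> nmu; exists p; split; first exact: rt_refl.
  move=> m mp rm; apply/andP; split; first exact: pmu.
  by apply: contraNneq nmu => <-; rewrite mp.
pose s := [seq m <- msupp p' | reducible G m].
have [s0|sn0] := eqVneq s [::].
  exists p'; split=> //; apply/irreducibleP => m mp'; apply/negP => rm.
  have : m \in s by rewrite mem_filter rm mp'.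
  by rewrite s0.
(* The largest reducible monomial of [p'] is the new bound, strictly below [mu]. *)
have [bmax /(_ sn0)] := bigmax_monP s; set b := \big[_/_]_(_ <- _) _ in bmax *.
rewrite mem_filter => /andP[rb bp'].
have [|r [p'r nr]] := IH b (p'mu b bp' rb) p'.
  by move=> m mp' rm; apply: bmax; rewrite mem_filter rm.
by exists r; split=> //; apply: rt_trans p'r.
Qed.

Lemma normal_form_ideal G p r :
  normal_form le G p r -> ideal_gen (fun g => g \in G) (p - r).
Proof.
move=> [pr _]; have idG := ideal_gen_ideal (fun g : {mpoly rat[n]} => g \in G).
have [I0 ID IM] := idG.
elim: pr => {p r} [p r [g [m [gG _ _ _ ->]]]|p|p q r _ Ipq _ Iqr].
- rewrite opprB addrC subrK; apply: ideal_scale => //; apply: IM.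
  exact: ideal_gen_incl.
- by rewrite subrr.
- by rewrite -[p](subrK q) -addrA; apply: ID.
Qed.

Lemma normal_form_irreducible G p r : normal_form le G p r -> irreducible G r.
Proof. by move=> [_ /irreducibleP]. Qed.

(** * Groebner bases: zero test, linearity of normal forms, existence *)

Lemma lead_ideal_reducible G p m :
  ideal_gen (fun l => exists2 g, g \in G & l = lead_term le g) p ->
  m \in msupp p -> reducible G m.
Proof.
move=> [r [rG ->]] /msupp_sum_le /flatten_mapP[x].
rewrite mem_filter /= => xr; have [g gG ->] := rG x xr.
have [->|g0] := eqVneq g 0.
  by rewrite /lead_term mcoeff0 scale0r mulr0 msupp0.
move=> /msuppM_le /allpairsP[[m1 m2] /= [_ m2g ->]]; apply/reducibleP.
exists g; split=> //; move: m2g => /msuppZ_le; rewrite msuppX inE => /eqP ->.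
exact: lem_addl.
Qed.

(** If [p] were non-zero, its leading term would lie in the ideal of leading terms of [G], so its
    leading monomial would be divisible by that of a non-zero element of [G]. *)
Lemma groebner_irreducible_eq0 I G p :
  groebner_basis le I G -> I p -> irreducible G p -> p = 0.
Proof.
move=> [_ GI] Ip irr; apply/eqP; apply/negPn/negP => p0.
have mp := lead_mon_supp p0.
have /negP := irr _ mp; apply; apply: (@lead_ideal_reducible G (lead_term le p)).
  by apply/GI; apply: ideal_gen_incl; exists p.
by rewrite msuppMCX ?inE ?eqxx // lead_coef_neq0.
Qed.

Lemma groebner_normal_form_eq0 I G p r : is_ideal I ->
  groebner_basis le I G -> I p -> normal_form le G p r -> r = 0.
Proof.
move=> idI GI Ip nf; apply: (groebner_irreducible_eq0 GI); last first.
  exact: normal_form_irreducible nf.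
suff -> : r = p - (p - r).
  by apply: ideal_sub => //; apply: ideal_gen_min (normal_form_ideal nf) => //; case: GI.
by rewrite opprB addrC subrK.
Qed.

(** [groebner_basis] compares only ideals of leading terms; generation of [I] follows because
    elements of [I] have normal form 0. *)
Lemma groebner_generates I G p : is_ideal I ->
  groebner_basis le I G -> I p -> ideal_gen (fun g => g \in G) p.
Proof.
move=> idI GI Ip; have [r nf] := normal_form_exists G p.
have := normal_form_ideal nf.
by rewrite (groebner_normal_form_eq0 idI GI Ip nf) subr0.
Qed.

(** The two sides are congruent modulo [I] and both irreducible, so their difference is an
    irreducible element of [I], hence 0. *)
Lemma groebner_normal_form_sum I G (red : {mpoly rat[n]} -> {mpoly rat[n]})
    (T : eqType) (s : seq T) (c : T -> rat) (v : T -> {mpoly rat[n]}) :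
  is_ideal I -> groebner_basis le I G ->
  (forall p, normal_form le G p (red p)) ->
  red (\sum_(i <- s) c i *: v i) = \sum_(i <- s) c i *: red (v i).
Proof.
move=> idI GI nf; have [I0 ID _] := idI.
have Ired p : I (p - red p).
  by apply: ideal_gen_min (normal_form_ideal (nf p)) => //; case: GI.
set p := \sum_(i <- s) _.
apply/eqP; rewrite -subr_eq0; apply/eqP.
apply: (groebner_irreducible_eq0 GI).
  rewrite -[red p](subrK p) -addrA -[red p - p]opprB addrC.
  apply: ideal_sub => //.
  rewrite -sumrB; apply: ideal_sum => // i _.
  by rewrite -scalerBr; apply: ideal_scale.
apply: irreducibleD; first exact: normal_form_irreducible (nf p).
rewrite -scaleN1r; apply: irreducibleZ.
elim/big_ind: _ => [||i _]; [exact: irreducible0|exact: irreducibleD|].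
by apply: irreducibleZ; apply: normal_form_irreducible (nf (v i)).
Qed.

(** Dickson's lemma gives a finite basis of the leading monomials of non-zero elements of [I]; [G]
    collects one polynomial of [I] for each basis monomial. *)
Lemma groebner_exists I : is_ideal I -> exists G, groebner_basis le I G.
Proof.
move=> idI.
have [s [sA sb]] := dickson (fun m => exists f, [/\ I f, f != 0 & lead_mon le f = m]).
have [G [GI Gs]] : exists G : {fset {mpoly rat[n]}},
    (forall g, g \in G -> I g) /\
    (forall m, m \in s -> exists g, [/\ g \in G, g != 0 & lead_mon le g = m]).
  elim: s sA {sb} => [|x s IH] sA; first by exists fset0.
  have [|G [GI Gs]] := IH; first by move=> m ms; apply: sA; rewrite inE ms orbT.
  have [f [If f0 fx]] := sA x (mem_head _ _).
  exists (f |` G); split=> [g|m]; first by rewrite !inE => /orP[/eqP ->|/GI].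
  rewrite inE => /orP[/eqP ->|/Gs[g [gG g0 gm]]].
    by exists f; rewrite !inE eqxx.
  by exists g; rewrite !inE gG orbT.
exists G; split=> // p; split; apply: ideal_gen_min; try exact: ideal_gen_ideal.
  by move=> _ [g /GI Ig ->]; apply: ideal_gen_incl; exists g.
move=> _ [f If ->]; set J := ideal_gen _.
have idJ : is_ideal J by exact: ideal_gen_ideal.
have [J0 _ JM] := idJ.
have [->|f0] := eqVneq f 0; first by rewrite /lead_term mcoeff0 scale0r.
have [|b /Gs[g [gG g0 <-]] gf] := sb (lead_mon le f); first by exists f.
have -> : lead_term le f = (f@_(lead_mon le f) / g@_(lead_mon le g)) *:
    ('X_[lead_mon le f - lead_mon le g] * lead_term le g).
  rewrite /lead_term -scalerAr scalerA divfK ?lead_coef_neq0 //.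
  by rewrite -mpolyXD submK.
apply: ideal_scale => //; apply: JM; apply: ideal_gen_incl.
by exists g.
Qed.

End Groebner.

(** * The saturation procedure *)

Section Saturate.
Variables (n : nat) (le : rel 'X_{1..n}).
Hypothesis le_mon : monomial_order le.
Implicit Types (p q t : {mpoly rat[n]}).
Implicit Types (Z P Q G : {fset {mpoly rat[n]}}) (s : state n).

(** * Termination and progress *)

Definition in_span d (v : 'I_d -> {mpoly rat[n]}) p : Prop :=
  exists c : 'I_d -> rat, p = \sum_i c i *: v i.

Lemma cone_in_span d (v : 'I_d -> {mpoly rat[n]}) P p :
  (forall q, q \in P -> in_span v q) -> cone P p -> in_span v p.
Proof.
apply: cone_min; split.
- by exists (fun=> 0); rewrite big1 // => i _; rewrite scale0r.
- move=> _ _ [c ->] [c' ->]; exists (fun i => c i + c' i).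
  by rewrite -big_split; apply: eq_bigr => i _; rewrite scalerDl.
- move=> a _ _ [c ->]; exists (fun i => a * c i).
  by rewrite scaler_sumr; apply: eq_bigr => i _; rewrite scalerA.
Qed.

(* Normal forms are linear, and a non-trivial linear relation
   0 = red t = \sum_i c_i red (v_i) expresses one of the red (v_i) by the
   others. *)
Lemma span_red_drop d (v : 'I_d.+1 -> {mpoly rat[n]})
    (red : {mpoly rat[n]} -> {mpoly rat[n]}) t :
  (forall c : 'I_d.+1 -> rat,
     red (\sum_i c i *: v i) = \sum_i c i *: red (v i)) ->
  t != 0 -> in_span v t -> red t = 0 ->
  exists w : 'I_d -> {mpoly rat[n]},
    forall p, in_span v p -> in_span w (red p).
Proof.
move=> red_lin t0 [c tE] redt0.
have [j cj0] : exists j, c j != 0.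
  apply: NNPP => nex; case/eqP: t0; rewrite tE big1 // => i _.
  have [->|ci] := eqVneq (c i) 0; first by rewrite scale0r.
  by case: nex; exists i.
exists (fun i => red (v (lift j i))) => _ [a ->].
have redj : red (v j) = \sum_i (- c (lift j i) / c j) *: red (v (lift j i)).
  move: redt0; rewrite tE red_lin (bigD1_ord j) //= => /eqP.
  rewrite addr_eq0 => /eqP cjE.
  rewrite -[red (v j)]scale1r -(mulVf cj0) -scalerA cjE scalerN -scaleNr.
  rewrite scaler_sumr; apply: eq_bigr => i _.
  by rewrite scalerA !mulNr mulrC.
exists (fun i => a j * (- c (lift j i) / c j) + a (lift j i)).
rewrite red_lin (bigD1_ord j) //= redj scaler_sumr -big_split.
by apply: eq_bigr => i _; rewrite scalerDl scalerA.
Qed.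

(** Induction on the size [d] of a family spanning the second component. The family need not be
    independent: an upper bound on the dimension that drops at each step suffices. *)
Lemma saturate_acc s : Acc (fun s' s => saturate_step le s s') s.
Proof.
suff main d : forall s (v : 'I_d -> {mpoly rat[n]}),
    (forall p, p \in s.2 -> in_span v p) ->
    Acc (fun s' s => saturate_step le s s') s.
  apply: (main _ s (fun i => tnth (in_tuple (enum_fset s.2)) i)) => p ps.
  have /tnthP[i ->] : p \in in_tuple (enum_fset s.2) by [].
  exists (fun j => (j == i)%:R); rewrite (bigD1 i) //= eqxx scale1r.
  by rewrite big1 ?addr0 // => j /negbTE ->; rewrite scale0r.
elim: d => [|d IH] {}s v sv; constructor=> -[G P'];
  case: s sv => Z P /= sv [t [t0 [Pt _] GI [red [nf P'E]]]].
  (* An empty family spans only 0, so no non-zero [t] can be chosen. *)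
  have [c tE] := cone_in_span sv Pt.
  by case/eqP: t0; rewrite tE big_ord0.
have idI := ideal_gen_ideal (fun g : {mpoly rat[n]} => g \in Z `|` [fset t]).
have [|||w vw] := @span_red_drop d v red t _ t0.
- by move=> c; apply: (groebner_normal_form_sum le_mon _ c v idI GI).
- exact: cone_in_span Pt.
- apply: (groebner_normal_form_eq0 le_mon idI GI _ (nf t)).
  by apply: ideal_gen_incl; rewrite !inE eqxx orbT.
apply: (IH _ w) => p; rewrite P'E => /imfsetP[q /=].
by rewrite !inE => /andP[qP _] ->; apply: vw; apply: sv.
Qed.

Lemma saturate_progress s :
  saturate_halted s \/ exists s', saturate_step le s s'.
Proof.
case: s => Z P; have [[t [t0 ut]]|] := classic (exists t, t != 0 /\ units (cone P) t);
  last by left.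
right; have idI := ideal_gen_ideal (fun g : {mpoly rat[n]} => g \in Z `|` [fset t]).
have [G GI] := groebner_exists le_mon idI.
(* A step asks for a function, so one normal form is chosen for each polynomial. *)
pose red p := proj1_sig (constructive_indefinite_description _
  (normal_form_exists le_mon G p)).
exists (G, [fset red p | p in P & red p != 0]); exists t; split=> //.
by exists red; split=> // p; rewrite /red; case: constructive_indefinite_description.
Qed.

(** * Invariants of a run and leastness of the result *)

Definition cone_meets_ideal_trivially s : Prop :=
  forall p, cone s.2 p -> ideal_gen (fun g => g \in s.1) p -> p = 0.

Definition contained_in_regular (D : {mpoly rat[n]} -> Prop) s : Prop :=
  (forall z, z \in s.1 -> units D z) /\ (forall p, p \in s.2 -> D p).

(** The new [P'] consists of normal forms, so its cone is irreducible modulo [G], while an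
    irreducible element of the ideal must be 0. *)
Lemma step_meets_trivially s s' :
  saturate_step le s s' -> cone_meets_ideal_trivially s'.
Proof.
case: s s' => Z P [G P'] [t [t0 ut GI [red [nf ->]]]] p /= Pp Gp.
apply: (groebner_irreducible_eq0 le_mon GI).
  by apply: ideal_gen_min Gp; [exact: ideal_gen_ideal|case: GI].
apply: irreducible_cone Pp => _ /imfsetP[q _ ->].
exact: normal_form_irreducible (nf q).
Qed.

(** The old [Z] lies in the ideal generated by [G], and each [p] in [P] is [red p] plus an element
    of that ideal. *)
Lemma step_alg_cone s s' p :
  saturate_step le s s' -> alg_cone s.1 s.2 p -> alg_cone s'.1 s'.2 p.
Proof.
case: s s' => Z P [G P'] [t [t0 ut GI [red [nf P'E]]]] /=.
have idI := ideal_gen_ideal (fun g : {mpoly rat[n]} => g \in Z `|` [fset t]).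
have idG := ideal_gen_ideal (fun g : {mpoly rat[n]} => g \in G).
have coneGP := alg_cone_cone G P'.
have [C0 CD _] := coneGP.
case=> z [q [Zz Pq ->]]; apply: (CD).
  apply: alg_cone_ideal; apply: ideal_gen_min Zz => // g gZ.
  apply: (groebner_generates le_mon idI GI).
  by apply: ideal_gen_incl; rewrite !inE gZ.
apply: cone_min Pq => // {}p pP; rewrite -[p](subrK (red p)); apply: CD.
  exact: alg_cone_ideal (normal_form_ideal (nf p)).
have [->|r0] := eqVneq (red p) 0; first exact: C0.
apply: alg_cone_incl; rewrite P'E; apply/imfsetP; exists p => //=.
by rewrite !inE pP.
Qed.

(** Both [t] and [- t] lie in [cone P], hence in [D], so [t] is a unit of [D]. As [units D] is an
    ideal it contains [G], and therefore [q - red q], which may be subtracted from [q] within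
    [D]. *)
Lemma step_contained_in_regular (D : {mpoly rat[n]} -> Prop) s s' :
  regular_cone D -> saturate_step le s s' ->
  contained_in_regular D s -> contained_in_regular D s'.
Proof.
case: s s' => Z P [G P'] regD [t [t0 [Pt Pnt] [GI _] [red [nf P'E]]]] [/= ZD PD].
have [coneD _ idD] := regD.
have GD g : g \in G -> units D g.
  move=> /GI; apply: ideal_gen_min => // q; rewrite !inE => /orP[/ZD //|/eqP ->].
  by split; apply: cone_min PD _.
split=> //= p; rewrite P'E => /imfsetP[q /=]; rewrite !inE => /andP[qP _] ->.
have -> : red q = q - (q - red q) by rewrite opprB addrC subrK.
case: (coneD) => _ DD _; apply: DD; first exact: PD.
by have [] := ideal_gen_min idD GD (normal_form_ideal (nf q)).
Qed.

Lemma saturate_reaches_ind Q (Inv : state n -> Prop) s :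
  Inv (saturate_init Q) ->
  (forall s s', saturate_step le s s' -> Inv s -> Inv s') ->
  saturate_reaches le Q s -> Inv s.
Proof.
move=> Inv0 InvS; rewrite /saturate_reaches => reach.
elim: reach Inv0 => [x y /InvS //|//|x y z _ IH1 _ IH2 /IH1].
exact: IH2.
Qed.

Lemma saturate_returns_least Q Z P :
  saturate_returns le Q (Z, P) ->
  least_regular_cone_containing Q (alg_cone Z P).
Proof.
move=> [reach halt].
have contains q : q \in Q `|` [fset 1] -> alg_cone Z P q.
  move=> qQ; apply: (saturate_reaches_ind (Inv := fun s => alg_cone s.1 s.2 q)
    _ _ reach); first exact: alg_cone_incl.
  by move=> s s' /step_alg_cone; apply.
have meets : cone_meets_ideal_trivially (Z, P).
  apply: (saturate_reaches_ind _ _ reach) => [p _|s s' /step_meets_trivially //].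
  (* Initially [Z] is empty and generates the zero ideal. *)
  apply: (ideal_gen_min (I := fun q => q = 0)) => [|q]; last by rewrite inE.
  by split=> [|p' q -> ->|p' q ->]; rewrite ?addr0 ?mulr0.
split.
- apply: alg_cone_regular => // [p up|]; last by apply: contains; rewrite !inE eqxx orbT.
  by apply: NNPP => /eqP p0; apply: halt; exists p.
- by move=> q qQ; apply: contains; rewrite !inE qQ.
- move=> D regD QD p; have [coneD D1 idD] := regD.
  have [ZD PD] : contained_in_regular D (Z, P).
    apply: (saturate_reaches_ind _ _ reach); last first.
      by move=> s s'; apply: step_contained_in_regular.
    (* The element 1 added to [Q] at the start lies in [D] by regularity. *)
    by split=> // q; rewrite !inE => /orP[/QD|/eqP ->].
  exact: alg_cone_min.
Qed.

End Saturate.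

Theorem theorem3p5 (n : nat) (le : rel 'X_{1..n})
    (Q : {fset {mpoly rat[n]}}) :
  monomial_order le ->
  saturate_terminates le Q /\
  (forall Z P : {fset {mpoly rat[n]}},
     saturate_returns le Q (Z, P) ->
     least_regular_cone_containing Q (alg_cone Z P)).
Proof.
move=> le_mon; split; last by move=> Z P; apply: saturate_returns_least.
split; first exact: saturate_acc.
by move=> s _; apply: saturate_progress.
Qed.
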